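(* Let $d\ge1$ and identify $\square^d=\{0,1\}^d$ with $\mathbb F_2^d$. In $\mathbb Z[\tfrac12][C_{\mathbf v}]_{\mathbf v\in\square^d}=\mathbb Z[\tfrac12][F_{\mathbf w}]_{\mathbf w\in\square^d}$, where $F_{\mathbf w}=\sum_{\mathbf v\in\square^d}(-1)^{\langle\mathbf v,\mathbf w\rangle}C_{\mathbf v}$, the ideal generated by $\mathscr I_{\mathrm{rat}}(\square^d)$ is generated by the following elements: - ($R^*1$) $F_{\mathbf 0}F_{\mathbf w}$, for all $\mathbf w\in\mathbb F_2^d$; - ($R^*2$) $F_{\mathbf e_i}(F_{\mathbf w}-F_{\mathbf w+\mathbf e_i})(F_{\mathbf z}+F_{\mathbf z+\mathbf e_i})$, for all $i\in\{1,\dots,d\}$ and $\mathbf w,\mathbf z\in\mathbb F_2^d$; - ($R^*3$) $(F_{\mathbf w+\mathbf e_i+\mathbf e_j}-F_{\mathbf w})(F_{\mathbf z+\mathbf e_i+\mathbf e_j}-F_{\mathbf z})-(F_{\mathbf w+\mathbf e_i}-F_{\mathbf w+\mathbf e_j})(F_{\mathbf z+\mathbf e_i}-F_{\mathbf z+\mathbf e_j})$, for all $i,j\in\{1,\dots,d\}$ and $\mathbf w,\mathbf z\in\mathbb F_2^d$. In particular, letting $\widetilde{\mathrm{Chow}}_{\mathrm{GS}}(\square^d)$ be the quotient of $\mathbb Z[F_{\mathbf w}]_{\mathbf w\in\square^d}$ by the ideal generated by ($R^*1$), ($R^*2$), ($R^*3$), one has $\widetilde{\mathrm{Chow}}_{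\mathrm{GS}}(\square^d)[\tfrac12]=\mathrm{Chow}_{\mathrm{GS}}(\square^d)[\tfrac12]$.
   Context: $\langle\mathbf v,\mathbf u\rangle=\sum_{i=1}^d v_iu_i\in\mathbb F_2$; $\mathbf e_i\in\mathbb F_2^d$ has $i$-th coordinate $1$ and all others $0$; $\mathbf 0$ is the zero vector. Since $C_{\mathbf v}=\frac1{2^d}\sum_{\mathbf w}(-1)^{\langle\mathbf v,\mathbf w\rangle}F_{\mathbf w}$, the $F_{\mathbf w}$ are another set of polynomial generators over $\mathbb Z[\frac12]$. $\square^d=\{0,1\}^d$ is ordered coordinatewise ($0<1$); (possibly repeated) vertices form a simplex of $\square^d$ iff they are pairwise comparable. $\mathscr I_{\mathrm{rat}}(\square^d)\subseteq\mathbb Z[C_{\mathbf v}]_{\mathbf v\in\square^d}$ is the ideal generated by: (R1) $C_{\mathbf v_1}\cdots C_{\mathbf v_k}$ whenever $\mathbf v_1,\dots,\mathbf v_k$ do not form a simplex; (R2) $C_{\mathbf u}\sum_{\mathbf v\in\square^d}C_{\mathbf v}$ for $\mathbf u\in\square^d$; (R3) $C_{\mathbf u}C_{\mathbf w}\sum_{\mathbf v\in\square^d:\,v_i=u_i}C_{\mathbf v}$ for $\mathbf u,\mathbf w\in\square^d$ and $1\le i\le d$ with $u_i\neq w_i$. $\mathrm{Chow}_{\mathrm{GS}}(\square^d)=\mathbb Z[C_{\mathbf v}]_{\mathbf v\in\square^d}/\mathscr I_{\mathrm{rat}}(\square^d)$. The notation $A[\frac12]$ means $A\otimes_{\mathbb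 Z}\mathbb Z[\frac12]$. *)

(* Defs.v *)
From HB Require Import structures.
From mathcomp Require Import all_boot all_algebra generic_quotient ring_quotient.
From mathcomp Require Import boolp freeg mpoly.

Set Implicit Arguments.
Unset Strict Implicit.
Unset Printing Implicit Defensive.

Import GRing.Theory Num.Theory.
Local Open Scope ring_scope.
Local Open Scope quotient_scope.

(* The library's {ideal_quot I} only covers proper ideals; a quotient (or a
   tensor product) may be the zero ring, hence comPzRingType here. *)
Section QuotientRing.
Variables (A : comPzRingType) (G : A -> Prop).

Definition ideal_gen (p : A) : Prop :=
  exists2 s : seq (A * A),
    forall x, x \in s -> G x.2 & p = \sum_(x <- s) x.1 * x.2.

Definition ideal_pred (p : A) : bool := `[< ideal_gen p >].

Lemma ideal_gen0 : ideal_gen 0.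
Proof. by exists [::] => //; rewrite big_nil. Qed.

Lemma ideal_genD p q : ideal_gen p -> ideal_gen q -> ideal_gen (p + q).
Proof.
move=> [s hs ->] [t ht ->]; exists (s ++ t); last by rewrite big_cat.
by move=> x; rewrite mem_cat => /orP[/hs|/ht].
Qed.

Lemma ideal_genMl a p : ideal_gen p -> ideal_gen (a * p).
Proof.
move=> [s hs ->]; exists [seq (a * x.1, x.2) | x <- s].
  by move=> x /mapP[y /hs hy ->].
by rewrite big_map mulr_sumr; apply: eq_bigr => x _; rewrite mulrA.
Qed.

Lemma mem_ideal_gen g : G g -> ideal_gen g.
Proof.
move=> Gg; exists [:: (1, g)]; last by rewrite big_seq1 mul1r.
by move=> x; rewrite inE => /eqP->.
Qed.

Fact ideal_pred_closed : zmod_closed (ideal_pred : {pred A}).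
Proof.
split=> [|p q /asboolP hp /asboolP hq]; apply/asboolP; first exact: ideal_gen0.
by apply: ideal_genD => //; rewrite -mulN1r; apply: ideal_genMl.
Qed.

HB.instance Definition _ := GRing.isZmodClosed.Build A ideal_pred ideal_pred_closed.

Definition ideal_zmod : zmodClosed A := GRing.ZmodClosed.clone A ideal_pred _.

Definition qring := Quotient.quot ideal_zmod.

HB.instance Definition _ := GRing.Zmodule.on qring.

Definition qpi (a : A) : qring := \pi_(Quotient.quot ideal_zmod) a.

Lemma qpi_eq a b : qpi a = qpi b <-> ideal_gen (a - b).
Proof.
split=> [/eqP|h]; last apply/eqP; rewrite -Quotient.idealrBE.
  by move/asboolP.
exact/asboolP.
Qed.

Definition qring_repr (x : qring) : A := repr (x : Quotient.quot ideal_zmod).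

Lemma qring_reprK : cancel qring_repr qpi.
Proof. exact: reprK. Qed.

Lemma qpi_is_zmod_morphism : zmod_morphism qpi.
Proof. move=> a b; exact: raddfB. Qed.

Definition qring_one : qring := qpi 1.
Definition qring_mul (x y : qring) : qring := qpi (qring_repr x * qring_repr y).

Lemma qpiM a b : qpi (a * b) = qring_mul (qpi a) (qpi b).
Proof.
apply/qpi_eq; set a' := qring_repr _; set b' := qring_repr _.
have ha : ideal_gen (a - a') by apply/qpi_eq; rewrite qring_reprK.
have hb : ideal_gen (b - b') by apply/qpi_eq; rewrite qring_reprK.
have -> : a * b - a' * b' = b * (a - a') + a' * (b - b').
  by rewrite !mulrBr ![b * _]mulrC addrA subrK.
by apply: ideal_genD; apply: ideal_genMl.
Qed.

Fact qring_mulA : associative qring_mul.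
Proof.
move=> x y z; rewrite -[x]qring_reprK -[y]qring_reprK -[z]qring_reprK.
by rewrite -!qpiM mulrA.
Qed.

Fact qring_mulC : commutative qring_mul.
Proof. by move=> x y; rewrite /qring_mul mulrC. Qed.

Fact qring_mul1 : left_id qring_one qring_mul.
Proof. by move=> x; rewrite -[x]qring_reprK -qpiM mul1r. Qed.

Fact qring_mulDl : left_distributive qring_mul +%R.
Proof.
move=> x y z; rewrite -[x]qring_reprK -[y]qring_reprK -[z]qring_reprK.
have qpiD : {morph qpi : a b / a + b} by move=> a b; apply: raddfD.
by rewrite -qpiD -!qpiM mulrDl qpiD.
Qed.

HB.instance Definition _ := GRing.Zmodule_isComPzRing.Build qring
  qring_mulA qring_mulC qring_mul1 qring_mulDl.

Fact qpi_is_monoid_morphism : monoid_morphism qpi.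
Proof. by split=> // a b; rewrite qpiM. Qed.

HB.instance Definition _ := GRing.isZmodMorphism.Build A qring qpi qpi_is_zmod_morphism.
HB.instance Definition _ := GRing.isMonoidMorphism.Build A qring qpi qpi_is_monoid_morphism.

End QuotientRing.

(* A (x)_Z B: the monoid ring Z[A x B] of the multiplicative monoid A x B, modulo
   the bilinearity relations.  A multiple of a bilinearity relation by a basis
   element is again one, so the ideal they generate is just their Z-span. *)
Section TensorProduct.
Variables A B : comPzRingType.

Definition pair_ring := {freeg (A * B) / int}.
HB.instance Definition _ := GRing.Lmodule.on pair_ring.

Definition pair_basis (a : A) (b : B) : pair_ring := << (a, b) >>.

Definition pair_mulU (x : A * B) (q : pair_ring) : pair_ring :=
  fglift (fun y => pair_basis (x.1 * y.1) (x.2 * y.2)) q.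
Definition pair_mul (p q : pair_ring) : pair_ring :=
  fglift (fun x => pair_mulU x q) p.

Lemma pair_ring_ext (M : zmodType) (f g : pair_ring -> M) :
  zmod_morphism f -> zmod_morphism g ->
  (forall a b, f (pair_basis a b) = g (pair_basis a b)) -> f =1 g.
Proof.
move=> hf hg fg p.
pose f' : {additive pair_ring -> M} := HB.pack f (GRing.isZmodMorphism.Build _ _ f hf).
pose g' : {additive pair_ring -> M} := HB.pack g (GRing.isZmodMorphism.Build _ _ g hg).
change (f' p = g' p); rewrite -(freeg_sumE p) !raddf_sum; apply: eq_bigr => -[a b] _.
by rewrite -[X in << X *g _ >>]intz -freegU_mulz !raddfMz /= [f _]fg.
Qed.

Fact pair_mulBl r : zmod_morphism (fun p => pair_mul p r).
Proof. by move=> p q; rewrite /pair_mul lift_is_additive. Qed.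

Fact pair_mulBr r : zmod_morphism (pair_mul r).
Proof.
move=> p q; move: r; apply: pair_ring_ext.
- exact: pair_mulBl.
- by move=> r s; rewrite !pair_mulBl !opprB addrACA [RHS]addrACA [- _ - _]addrC.
by move=> a b; rewrite /pair_mul !liftU !scale1r /pair_mulU lift_is_additive.
Qed.

Lemma pair_mulE a b a' b' :
  pair_mul (pair_basis a b) (pair_basis a' b') = pair_basis (a * a') (b * b').
Proof. by rewrite /pair_mul liftU scale1r /pair_mulU liftU scale1r. Qed.

Fact pair_mulA : associative pair_mul.
Proof.
move=> p q r; move: p; apply: pair_ring_ext.
- exact: pair_mulBl.
- by move=> p p'; rewrite !pair_mulBl.
move=> a b; move: q; apply: pair_ring_ext.
- by move=> q q'; rewrite pair_mulBl pair_mulBr.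
- by move=> q q'; rewrite pair_mulBr pair_mulBl.
move=> a' b'; move: r; apply: pair_ring_ext.
- by move=> r r'; rewrite !pair_mulBr.
- exact: pair_mulBr.
by move=> c d; rewrite !pair_mulE !mulrA.
Qed.

Fact pair_mulC : commutative pair_mul.
Proof.
move=> p q; move: p; apply: pair_ring_ext.
- exact: pair_mulBl.
- exact: pair_mulBr.
move=> a b; move: q; apply: pair_ring_ext.
- exact: pair_mulBr.
- exact: pair_mulBl.
by move=> c d; rewrite !pair_mulE [c * a]mulrC [d * b]mulrC.
Qed.

Fact pair_mul1 : left_id (pair_basis 1 1) pair_mul.
Proof.
apply: pair_ring_ext; first exact: pair_mulBr.
  by [].
by move=> a b; rewrite pair_mulE !mul1r.
Qed.

Fact pair_mulDl : left_distributive pair_mul +%R.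
Proof.
move=> p q r; pose f : {additive pair_ring -> pair_ring} :=
  HB.pack (fun p' => pair_mul p' r) (GRing.isZmodMorphism.Build _ _ _ (pair_mulBl r)).
exact: (raddfD f).
Qed.

HB.instance Definition _ := GRing.Zmodule_isComPzRing.Build pair_ring
  pair_mulA pair_mulC pair_mul1 pair_mulDl.

Variant bilinear_rel : pair_ring -> Prop :=
| Bilinear_l a a' b :
    bilinear_rel (pair_basis (a + a') b - pair_basis a b - pair_basis a' b)
| Bilinear_r a b b' :
    bilinear_rel (pair_basis a (b + b') - pair_basis a b - pair_basis a b').

Definition tensor := qring bilinear_rel.
HB.instance Definition _ := GRing.ComPzRing.on tensor.

Definition tens (a : A) (b : B) : tensor := qpi bilinear_rel (pair_basis a b).

Lemma tensDl a a' b : tens (a + a') b = tens a b + tens a' b.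
Proof.
rewrite /tens -raddfD; apply/qpi_eq; rewrite opprD addrA.
exact/mem_ideal_gen/Bilinear_l.
Qed.

Lemma tensDr a b b' : tens a (b + b') = tens a b + tens a b'.
Proof.
rewrite /tens -raddfD; apply/qpi_eq; rewrite opprD addrA.
exact/mem_ideal_gen/Bilinear_r.
Qed.

Lemma tens1 : tens 1 1 = 1.
Proof. by []. Qed.

Lemma tensM a b a' b' : tens a b * tens a' b' = tens (a * a') (b * b').
Proof. by rewrite /tens -[LHS]qpiM -pair_mulE. Qed.

End TensorProduct.

(* Z[1/2] as a subring of the rationals. *)

Definition dyadic (x : rat) : bool := `[< exists n : nat, x * 2 ^+ n \is a Num.int >].

Fact dyadic_subring : subring_closed (dyadic : {pred rat}).
Proof.
split=> [|x y /asboolP[m hx] /asboolP[n hy]|x y /asboolP[m hx] /asboolP[n hy]];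
  apply/asboolP; first by exists 0%N; rewrite mulr1 rpred1.
  exists (m + n)%N; rewrite exprD mulrBl mulrA [2 ^+ m * _]mulrC mulrA.
  by apply: rpredB; apply: rpredM => //; rewrite rpredX ?rpred_nat.
by exists (m + n)%N; rewrite exprD mulrACA rpredM.
Qed.

HB.instance Definition _ := GRing.isSubringClosed.Build rat dyadic dyadic_subring.

Record Zhalf := MkZhalf { Zhalf_val : rat; _ : Zhalf_val \in dyadic }.
HB.instance Definition _ := [isSub for Zhalf_val].
HB.instance Definition _ := [Choice of Zhalf by <:].
HB.instance Definition _ := [SubChoice_isSubComNzRing of Zhalf by <:].


Notation cube d := 'rV['F_2]_d.

Definition dotF2 d (v u : cube d) : 'F_2 := \sum_(i < d) v 0 i * u 0 i.

Definition basis_vec d (i : 'I_d) : cube d := delta_mx 0 i.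

(* The order 0 < 1 on coordinates is that of the representatives in nat. *)
Definition cube_le d (u v : cube d) : bool := [forall i, (u ord0 i <= v ord0 i)%N].

Definition is_simplex d (s : seq (cube d)) : bool :=
  all2rel (fun u v => cube_le u v || cube_le v u) s.

(* The relations are stated in any ring P for any family of elements of P
   indexed by the vertices, since they are used in several polynomial rings. *)
Section Relations.
Variables (d : nat) (P : comPzRingType).

Definition hadamard (C : cube d -> P) (w : cube d) : P :=
  \sum_v (-1) ^+ (dotF2 v w : nat) * C v.

Variant rat_rel (C : cube d -> P) : P -> Prop :=
| RatR1 (s : seq (cube d)) of ~~ is_simplex s :
    rat_rel C (\prod_(v <- s) C v)
| RatR2 (u : cube d) :
    rat_rel C (C u * \sum_v C v)
| RatR3 (u w : cube d) (i : 'I_d) of u 0 i != w 0 i :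
    rat_rel C (C u * C w * \sum_(v : cube d | v 0 i == u 0 i) C v).

Local Notation e := (@basis_vec d).

Variant star_rel (F : cube d -> P) : P -> Prop :=
| StarR1 (w : cube d) :
    star_rel F (F 0 * F w)
| StarR2 (i : 'I_d) (w z : cube d) :
    star_rel F (F (e i) * (F w - F (w + e i)) * (F z + F (z + e i)))
| StarR3 (i j : 'I_d) (w z : cube d) :
    star_rel F ((F (w + e i + e j) - F w) * (F (z + e i + e j) - F z)
                - (F (w + e i) - F (w + e j)) * (F (z + e i) - F (z + e j))).

End Relations.

(* R[X_v]_(v in cube d); the 2^d variables are numbered by the enumeration of
   the cube. *)
Notation cube_poly d R := {mpoly R[#|{: cube d}|]}.

Section ChowRings.
Variable d : nat.

Definition cube_var (R : comNzRingType) (v : cube d) : cube_poly d R := 'X_(enum_rank v).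

Definition I_rat : cube_poly d int -> Prop := ideal_gen (rat_rel (cube_var int)).
Definition Chow_GS := qring (rat_rel (cube_var int)).
Definition Chow_GS_tilde := qring (star_rel (cube_var int)).

End ChowRings.

Arguments I_rat : clear implicits.

(* Main.v *)
(* Write H_S(w) for the part of F_w = sum_v (-1)^<v,w> C_v supported on a set S
   of vertices.  Characters of F_2^d are orthogonal, so once 2 is invertible the
   products H_S(w) H_T(z) over all w, z span the same module as the products
   C_u C_v over u in S, v in T.  Moreover w -> w + e_i multiplies H_S by
   (-1)^a when S lies in the face v_i = a.  Up to powers of 2, (R*1) is then (R2);
   (R*2) is (R3), because F_{e_i} is the difference of two facet sums whose sum
   F_0 is already annihilated; and (R*3) is the symmetrized product
   H_S(w) H_T(z) + H_T(w) H_S(z) with S = {v_i = 0, v_j = 1} and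
   T = {v_i = 1, v_j = 0}, which is desymmetrized by shifting w by e_i and gives
   the products C_u C_v of incomparable vertices, i.e. (R1).

   All of this is a statement on the vanishing of relations for a family C in an
   arbitrary ring where 2 is invertible; applied to quotient rings it compares
   the ideals, and applied to the tensor products it shows that X_w -> F_w and
   X_v -> 2^-d F_v induce mutually inverse morphisms. *)
Require Import Defs.
From HB Require Import structures.
From mathcomp Require Import all_boot all_algebra.
From mathcomp Require Import boolp freeg mpoly.
From mathcomp Require Import ring.

Set Implicit Arguments.
Unset Strict Implicit.
Unset Printing Implicit Defensive.

Import GRing.Theory.
Local Open Scope ring_scope.

(** * Characters of [cube d] and partial Hadamard transforms *)

Lemma F2_cases (a : 'F_2) : (a == 0) || (a == 1).
Proof. by case: a => -[|[|]]. Qed.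

Lemma F2_neq0 (a : 'F_2) : (a != 0) = (a == 1).
Proof. by case/orP: (F2_cases a) => /eqP ->. Qed.

Section Signs.
Variables (d : nat) (P : comPzRingType).
Implicit Types (u v w z : cube d) (S T : pred (cube d)) (C : cube d -> P).

Definition csign v w : P := (-1) ^+ (dotF2 v w : nat).

(** Addition in ['F_2] and in [nat] differ by a multiple of 2, which powers of -1 do not see. *)
Lemma sign_F2D (a b : 'F_2) :
  (-1) ^+ ((a + b)%R : nat) = (-1) ^+ (a : nat) * (-1) ^+ (b : nat) :> P.
Proof.
by rewrite -exprD -[RHS]signr_odd -modn2; case: a b => -[|[|]] // ? [[|[|]]].
Qed.

Lemma csignC v w : csign v w = csign w v.
Proof. by rewrite /csign /dotF2; under eq_bigr do rewrite mulrC. Qed.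

Lemma csignDr v w z : csign v (w + z) = csign v w * csign v z.
Proof.
rewrite -sign_F2D /csign /dotF2 -big_split /=.
by under eq_bigr do rewrite mxE mulrDr.
Qed.

Lemma dotF2_basis v i : dotF2 v (basis_vec i) = v 0 i.
Proof.
rewrite /dotF2 (bigD1 i) // big1 => [|j ji]; rewrite /basis_vec mxE ?eqxx.
  by rewrite Monoid.mulm1 mulr1.
by rewrite (negbTE ji) andbF mulr0.
Qed.

Lemma csign_basis v i : csign v (basis_vec i) = (-1) ^+ (v 0 i : nat).
Proof. by rewrite /csign dotF2_basis. Qed.

Lemma csign0 v : csign v 0 = 1.
Proof. by rewrite /csign /dotF2 big1 // => i _; rewrite mxE mulr0. Qed.

Lemma csign_sq v w : csign v w * csign v w = 1.
Proof. by rewrite -expr2 /csign exprAC sqrrN !expr1n. Qed.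

Lemma F2_addrr (a : 'F_2) : a + a = 0.
Proof. by case/orP: (F2_cases a) => /eqP ->; apply/val_inj. Qed.

Lemma cube_addrr v : v + v = 0.
Proof. by apply/rowP => i; rewrite !mxE F2_addrr. Qed.

Lemma cube_eq (u v : cube d) : (u + v == 0) = (u == v).
Proof. by rewrite -[v in LHS]opprK subr_eq0 -[- v]add0r -(cube_addrr v) addrK. Qed.

Hypothesis half : exists h : P, h * 2 = 1.

Lemma mulr2_eq0 (x : P) : 2 * x = 0 -> x = 0.
Proof. by case: half => h h2 x0; rewrite -[x]mul1r -h2 -mulrA x0 mulr0. Qed.

Lemma pow2_eq0 n (x : P) : 2 ^+ n * x = 0 -> x = 0.
Proof. by elim: n => [|n IH]; rewrite ?mul1r // exprS -mulrA => /mulr2_eq0. Qed.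

(** For w nonzero at i, translating v by e_i reverses every sign, so the sum is its own negative and
    vanishes since 2 is invertible. *)
Lemma csign_sum w : \sum_v csign v w = if w == 0 then 2 ^+ d else 0.
Proof.
case: eqP => [->|/eqP w0].
  under eq_bigr do rewrite csign0.
  by rewrite sumr_const card_mx mul1n card_Fp // natrX.
have [i wi]: exists i, w ord0 i != 0.
  apply/existsP; apply: contraNT w0; rewrite negb_exists => /forallP w0.
  apply/eqP/rowP => i.
  by rewrite mxE; apply/eqP; move: (w0 i); rewrite negbK.
apply: mulr2_eq0; rewrite mulr_natl mulr2n {1}(reindex_inj (addIr (basis_vec i))) /=.
rewrite -big_split big1 // => v _ /=; rewrite [csign (_ + _) _]csignC csignDr -csignC csign_basis.
by move: wi; rewrite F2_neq0 => /eqP->; rewrite expr1 mulrN1 addNr.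
Qed.

Definition hadamard_on (S : pred (cube d)) (C : cube d -> P) w : P :=
  \sum_(v | S v) csign v w * C v.

(** Orthogonality leaves only the term u = v. The frequency w runs over the whole space whatever S
    is, hence the factor [2 ^+ d]. *)
Lemma hadamard_on_inv S C v : S v ->
  \sum_w csign v w * hadamard_on S C w = 2 ^+ d * C v.
Proof.
move=> Sv; under eq_bigr do rewrite mulr_sumr.
rewrite exchange_big /= (bigD1 v) //= [X in _ + X]big1 ?addr0 => [|u /andP[_ uv]].
  under eq_bigr do rewrite mulrA csign_sq mul1r.
  by rewrite sumr_const card_mx mul1n card_Fp // -natrX mulr_natl.
under eq_bigr do rewrite mulrA csignC [csign u _]csignC -csignDr.
by rewrite -mulr_suml csign_sum cube_eq eq_sym (negbTE uv) mul0r.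
Qed.

Lemma hadamardK C v : hadamard (hadamard C) v = 2 ^+ d * C v.
Proof.
rewrite -(@hadamard_on_inv predT) //; apply: eq_bigr => w _.
by rewrite -[_ ^+ _]/(csign w v) csignC.
Qed.

(** By inversion each family consists of combinations of the other, up to a power of 2. The spare
    factor [x] lets the lemma act on one factor of a product at a time. *)
Lemma hadamard_on_vanish S C (x : P) :
  (forall w, hadamard_on S C w * x = 0) <-> (forall u, S u -> C u * x = 0).
Proof.
split=> [h u Su|h w].
  apply: (@pow2_eq0 d); rewrite mulrA -(hadamard_on_inv _ Su) mulr_suml big1 // => w _.
  by rewrite -mulrA h mulr0.
by rewrite mulr_suml big1 // => v Sv; rewrite -mulrA h ?mulr0.
Qed.

Lemma hadamard_on_vanish2 S T C (x : P) :
  (forall w z, hadamard_on S C w * hadamard_on T C z * x = 0) <->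
  (forall u v, S u -> T v -> C u * C v * x = 0).
Proof.
split=> h.
  move=> u v Su Tv; rewrite -mulrA; move: u Su; apply/hadamard_on_vanish => w.
  rewrite mulrCA; move: v Tv; apply/hadamard_on_vanish => z.
  by rewrite mulrCA mulrA.
move=> w z; rewrite -mulrA; move: w; apply/hadamard_on_vanish => u Su.
rewrite mulrCA; move: z; apply/hadamard_on_vanish => v Tv.
by rewrite mulrCA mulrA h.
Qed.

Lemma hadamard_on_shift S C i (a : 'F_2) w :
  (forall v, S v -> v 0 i = a) ->
  hadamard_on S C (w + basis_vec i) = (-1) ^+ (a : nat) * hadamard_on S C w.
Proof.
move=> Sa; rewrite mulr_sumr; apply: eq_bigr => v Sv.
by rewrite csignDr csign_basis (Sa _ Sv) mulrA [csign v w * _]mulrC.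
Qed.

Lemma hadamard_onID C S w :
  hadamard C w = hadamard_on S C w + hadamard_on (predC S) C w.
Proof. exact: bigID. Qed.

Lemma hadamard_on0 S C : hadamard_on S C 0 = \sum_(v | S v) C v.
Proof. by apply: eq_bigr => v _; rewrite csign0 mul1r. Qed.

Lemma hadamard0 C : hadamard C 0 = \sum_v C v.
Proof. exact: hadamard_on0. Qed.

Definition face i (a : 'F_2) : pred (cube d) := [pred v : cube d | v 0 i == a].

Lemma hadamard_face C i w :
  hadamard C w = hadamard_on (face i 0) C w + hadamard_on (face i 1) C w.
Proof.
rewrite (hadamard_onID C (face i 0)); congr (_ + _).
by apply: eq_bigl => v /=; rewrite F2_neq0.
Qed.

Lemma hadamard_face_shift C i w :
  hadamard C (w + basis_vec i) =
  hadamard_on (face i 0) C w - hadamard_on (face i 1) C w.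
Proof.
rewrite (hadamard_face C i) (@hadamard_on_shift _ _ _ 0) => [|v /eqP //].
rewrite (@hadamard_on_shift _ _ _ 1) => [|v /eqP //].
by rewrite mul1r mulN1r.
Qed.

Lemma hadamard_basis C i :
  hadamard C (basis_vec i) =
  \sum_(v | face i 0 v) C v - \sum_(v | face i 1 v) C v.
Proof. by rewrite -[basis_vec i]add0r hadamard_face_shift !hadamard_on0. Qed.

(** The case i = j is included: the faces 01 and 10 are then empty, in accordance with (R*3) being
    0. *)
Definition face2 i j (a b : 'F_2) : pred (cube d) := predI (face i a) (face j b).

Lemma hadamard_on_face2 C i j a w :
  hadamard_on (face i a) C w =
  hadamard_on (face2 i j a 0) C w + hadamard_on (face2 i j a 1) C w.
Proof.
rewrite /hadamard_on (bigID (face j 0)) /=; congr (_ + _).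
by apply: eq_bigl => v /=; rewrite F2_neq0.
Qed.

(** Shifting by e_i and e_j multiplies the piece H_ab by (-1)^a and (-1)^b. The brackets become
    -2(H_01 + H_10) and 2(H_01 - H_10), and the difference of the two products keeps 8 times the
    mixed terms. *)
Lemma star3E C i j w z :
  let F := hadamard C in
  (F (w + basis_vec i + basis_vec j) - F w) *
    (F (z + basis_vec i + basis_vec j) - F z) -
  (F (w + basis_vec i) - F (w + basis_vec j)) *
    (F (z + basis_vec i) - F (z + basis_vec j)) =
  2 ^+ 3 * (hadamard_on (face2 i j 0 1) C w * hadamard_on (face2 i j 1 0) C z +
            hadamard_on (face2 i j 1 0) C w * hadamard_on (face2 i j 0 1) C z).
Proof.
have shi a b y : hadamard_on (face2 i j a b) C (y + basis_vec i) =
    (-1) ^+ (a : nat) * hadamard_on (face2 i j a b) C y.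
  by apply: hadamard_on_shift => v /andP[/eqP].
have shj a b y : hadamard_on (face2 i j a b) C (y + basis_vec j) =
    (-1) ^+ (b : nat) * hadamard_on (face2 i j a b) C y.
  by apply: hadamard_on_shift => v /andP[_ /eqP].
rewrite /= !(hadamard_face C i) !(hadamard_on_face2 _ i j) !(shi, shj) /=.
by ring.
Qed.
End Signs.

(** * Equivalence of the two sets of relations when 2 is invertible *)

Section Vanishing.
Variables (d : nat) (P : comPzRingType) (C : cube d -> P).
Hypothesis half : exists h : P, h * 2 = 1.
Implicit Types u v w z : cube d.

Lemma cube_leNP u v :
  reflect (exists i, u 0 i = 1 /\ v 0 i = 0) (~~ cube_le u v).
Proof.
rewrite negb_forall; apply: (iffP existsP) => -[i]; last first.
  by move=> [ui vi]; exists i; rewrite ui vi.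
move=> h; exists i; move: h.
by case/orP: (F2_cases (u 0 i)) => /eqP ->; case/orP: (F2_cases (v 0 i)) => /eqP ->.
Qed.

(** Two vertices are incomparable when two coordinates order them oppositely. This reduces (R1) to
    quadratic monomials. *)
Lemma is_simplexNP (s : seq (cube d)) :
  reflect (exists i j u v, [/\ u \in s, v \in s, face2 i j 0 1 u & face2 i j 1 0 v])
          (~~ is_simplex s).
Proof.
apply: (iffP idP) => [|[i [j [u [v [us vs /andP[/eqP ui /eqP uj] /andP[/eqP vi /eqP vj]]]]]]].
  case/allPn => u us /allPn[v vs]; rewrite negb_or.
  move=> /andP[/cube_leNP[j [uj vj]] /cube_leNP[i [vi ui]]].
  by exists i, j, u, v; split => //; apply/andP; split; apply/eqP.
apply/negP => /allrelP /(_ _ _ us vs) /orP[]; apply/negP; apply/cube_leNP.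
  by exists j.
by exists i.
Qed.

(** Since [u != v], removing one copy of u from s leaves v in place. *)
Lemma prod_eq0 (s : seq (cube d)) u v :
  u \in s -> v \in s -> u != v -> C u * C v = 0 -> \prod_(x <- s) C x = 0.
Proof.
move=> us vs uv uv0; rewrite (big_rem _ us) (big_rem v) /=.
  by rewrite mulrA uv0 mul0r.
move: vs; rewrite (perm_mem (perm_to_rem us)) inE eq_sym.
by rewrite (negbTE uv).
Qed.

Definition kills (G : P -> Prop) := forall g, G g -> g = 0.

Lemma kills_star_rel : kills (rat_rel C) -> kills (star_rel (hadamard C)).
Proof.
move=> rat0 _ [w|i w z|i j w z].
- rewrite hadamard0 mulrC mulr_suml big1 // => u _.
  by rewrite -mulrA (rat0 (C u * \sum_v C v)) ?mulr0 //; constructor.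
- rewrite hadamard_basis; set A := _ - _.
  rewrite !hadamard_face_shift !(hadamard_face C i).
  (* [A] is F_{e_i}, the difference of the two facet sums; by (R3) each facet sum kills C_u C_v for
     u, v in opposite facets. *)
  have: forall w z, hadamard_on (face i 1) C w * hadamard_on (face i 0) C z * A = 0.
    apply/hadamard_on_vanish2 => // u v /eqP ui /eqP vi; rewrite mulrBr.
    have R3u : C u * C v * \sum_(x | face i 1 x) C x = 0.
      by apply: rat0; rewrite -ui; apply: RatR3; rewrite ui vi.
    have R3v : C v * C u * \sum_(x | face i 0 x) C x = 0.
      by apply: rat0; rewrite -vi; apply: RatR3; rewrite ui vi.
    by rewrite R3u [C u * _]mulrC R3v subr0.
  (* The last two factors of (R*2) are 2 H_1(w) and 2 H_0(z), whence the 4. *)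
  move=> /(_ w z) e; transitivity
    (4 * (hadamard_on (face i 1) C w * hadamard_on (face i 0) C z * A)).
    by ring.
  by rewrite e mulr0.
(* Both mixed products vanish separately, because every vertex of the face 01 is incomparable to
   every vertex of the face 10. *)
rewrite star3E; have sw a b : forall w z, (a != b) ->
   hadamard_on (face2 i j a b) C w * hadamard_on (face2 i j b a) C z = 0.
  move=> w' z' ab; rewrite -[LHS]mulr1; move: w' z'.
  apply/hadamard_on_vanish2 => // u v hu hv.
  rewrite mulr1; transitivity (\prod_(x <- [:: u; v]) C x).
    by rewrite !big_cons big_nil mulr1.
  apply/rat0; constructor; apply/is_simplexNP; exists i, j.
  move: ab hu hv; case/orP: (F2_cases a) => /eqP ->;
    case/orP: (F2_cases b) => /eqP -> // _ hu hv.
    by exists u, v; split; rewrite // !inE eqxx ?orbT.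
  by exists v, u; split; rewrite // !inE eqxx ?orbT.
by rewrite !sw // addr0 mulr0.
Qed.

Lemma kills_rat_rel : kills (star_rel (hadamard C)) -> kills (rat_rel C).
Proof.
move=> star0.
have sumC u : C u * \sum_v C v = 0.
  move: u isT; apply/(hadamard_on_vanish half predT) => w.
  by rewrite -hadamard0 mulrC; apply: star0; constructor.
(* (R*2) controls only the difference of the two facet sums; their sum is F_0, which [sumC]
   controls. *)
have edge i u v : face i 1 u -> face i 0 v ->
    C u * C v * (\sum_(v | face i 0 v) C v - \sum_(v | face i 1 v) C v) = 0.
  move: u v; apply/hadamard_on_vanish2 => // w z.
  apply: (@pow2_eq0 _ half 2).
  rewrite -hadamard_basis -[RHS](star0 _ (@StarR2 _ _ _ i w z)) !hadamard_face_shift.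
  by rewrite !(hadamard_face C i); ring.
have sumE i : \sum_v C v = \sum_(v | face i 0 v) C v + \sum_(v | face i 1 v) C v.
  by rewrite -hadamard0 (hadamard_face C i) !hadamard_on0.
move=> _ [s /is_simplexNP[i [j [u [v [us vs hu hv]]]]]|u|u w i uw].
- apply: (prod_eq0 us vs).
    apply/eqP => uv; move: hu hv; rewrite uv.
    by move=> /andP[/eqP v0 _] /andP[/eqP]; rewrite v0.
  rewrite -[LHS]mulr1; move: u v hu hv {us vs}; apply/hadamard_on_vanish2 => // w z.
  (* Replacing w by w + e_i fixes H_01(w) and negates H_10(w). Adding the instances of (R*3) at w
     and w + e_i therefore isolates 16 H_01(w) H_10(z). *)
  rewrite mulr1; apply: (@pow2_eq0 _ half 4).
  have e1 := star0 _ (@StarR3 _ _ _ i j w z); rewrite star3E in e1.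
  have e2 := star0 _ (@StarR3 _ _ _ i j (w + basis_vec i) z); rewrite star3E in e2.
  move: e2; rewrite (@hadamard_on_shift _ _ _ _ _ 0) => [|v /andP[/eqP] //].
  rewrite (@hadamard_on_shift _ _ _ _ _ 1) => [e2|v /andP[/eqP] //].
  by rewrite -[RHS](addr0 0) -{1}e1 -e2; ring.
- exact: sumC.
(* The sum and the difference of the facet sums are both killed, hence so is twice each of them. *)
- have e u' v' : face i 1 u' -> face i 0 v' ->
    C u' * C v' * (\sum_(v | face i 0 v) C v) = 0 /\
    C u' * C v' * (\sum_(v | face i 1 v) C v) = 0.
    move=> hu hv; have := edge _ _ _ hu hv.
    have: C u' * C v' * \sum_v C v = 0 by rewrite mulrAC sumC mul0r.
    rewrite (sumE i); move: (\sum_(_ | _) _) (\sum_(_ | _) _) => b a abD abB.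
    split; apply: (mulr2_eq0 half).
      transitivity (C u' * C v' * (a + b) + C u' * C v' * (a - b)); first by ring.
      by rewrite abD abB addr0.
    transitivity (C u' * C v' * (a + b) - C u' * C v' * (a - b)); first by ring.
    by rewrite abD abB subr0.
  move: uw; case/orP: (F2_cases (u 0 i)) => /eqP ui;
    case/orP: (F2_cases (w 0 i)) => /eqP wi.
  + by rewrite ui wi.
  + by rewrite ui [C u * _]mulrC => _; apply: (e w u _ _).1; apply/eqP.
  + by rewrite ui => _; apply: (e u w _ _).2; apply/eqP.
  + by rewrite ui wi.
Qed.
End Vanishing.

(** * Transport of the relations along ring morphisms *)

Section RelationsMorphism.
Variables (d : nat) (P Q : comPzRingType) (f : {rmorphism P -> Q}).
Variables (C : cube d -> P) (C' : cube d -> Q).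
Hypothesis fC : forall v, f (C v) = C' v.

Lemma rmorph_hadamard w : f (hadamard C w) = hadamard C' w.
Proof.
rewrite rmorph_sum; apply: eq_bigr => v _.
by rewrite rmorphM rmorphXn rmorphN1 fC.
Qed.

Lemma rat_rel_morph p : rat_rel C p -> rat_rel C' (f p).
Proof.
case=> [s hs|u|u w i uw].
- rewrite rmorph_prod; under eq_bigr do rewrite fC.
  exact: RatR1.
- by rewrite rmorphM rmorph_sum fC; under eq_bigr do rewrite fC; apply: RatR2.
by rewrite !rmorphM rmorph_sum !fC; under eq_bigr do rewrite fC; apply: RatR3.
Qed.

(** A relation for the image family is the image of the relation with the same indices. Thus the
    relations of the projected family vanish in a quotient once those upstairs lie in the ideal. *)
Lemma rat_rel_morph_inv q : rat_rel C' q -> exists2 p, rat_rel C p & q = f p.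
Proof.
case=> [s hs|u|u w i uw].
- exists (\prod_(v <- s) C v); first exact: RatR1.
  by rewrite rmorph_prod; under [RHS]eq_bigr do rewrite fC.
- exists (C u * \sum_v C v); first exact: RatR2.
  by rewrite rmorphM rmorph_sum fC; under [in RHS]eq_bigr do rewrite fC.
exists (C u * C w * \sum_(v : cube d | v 0 i == u 0 i) C v); first exact: RatR3.
by rewrite !rmorphM rmorph_sum !fC; under [in RHS]eq_bigr do rewrite fC.
Qed.

Lemma star_rel_morph p : star_rel C p -> star_rel C' (f p).
Proof.
by case=> [w|i w z|i j w z]; rewrite !(rmorphB, rmorphM, rmorphD) !fC; constructor.
Qed.

Lemma star_rel_morph_inv q : star_rel C' q -> exists2 p, star_rel C p & q = f p.
Proof.
case=> [w|i w z|i j w z]; eexists; [exact: (StarR1 _ w)| |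
  exact: (StarR2 _ i w z)| |exact: (StarR3 _ i j w z)|];
  by rewrite !(rmorphB, rmorphM, rmorphD) !fC.
Qed.
End RelationsMorphism.

(** * Comparison of the two ideals *)

Lemma sub_ideal_gen (A : comPzRingType) (G H : A -> Prop) :
  (forall g, G g -> ideal_gen H g) -> forall p, ideal_gen G p -> ideal_gen H p.
Proof.
move=> GH p [s hs ->]; rewrite big_seq; apply: big_ind => [|? ?|x xs].
- exact: ideal_gen0.
- exact: ideal_genD.
by apply/ideal_genMl/GH/hs.
Qed.

Lemma qpi_eq0 (A : comPzRingType) (G : A -> Prop) p :
  qpi G p = 0 <-> ideal_gen G p.
Proof. by rewrite -(rmorph0 (qpi G)) qpi_eq subr0. Qed.

Lemma rmorph_half (A B : comPzRingType) (f : {rmorphism A -> B}) :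
  (exists h : A, h * 2 = 1) -> exists h : B, h * 2 = 1.
Proof. by case=> h h2; exists (f h); rewrite -(rmorph_nat f) -rmorphM h2 rmorph1. Qed.

(** For each inclusion, pass to the quotient by the target ideal: 2 stays invertible and the target
    relations vanish there, so the generators of the other ideal vanish too. *)
Lemma ideal_rat_star (d : nat) (P : comPzRingType) (C : cube d -> P) p :
  (exists h : P, h * 2 = 1) ->
  ideal_gen (rat_rel C) p <-> ideal_gen (star_rel (hadamard C)) p.
Proof.
move=> half; split; apply: sub_ideal_gen => {}p hp; apply/qpi_eq0.
  set f := qpi _.
  have halfQ := rmorph_half f half.
  apply: (@kills_rat_rel _ _ (f \o C) halfQ); last by apply: rat_rel_morph hp.
  move=> _ /(star_rel_morph_inv (@rmorph_hadamard _ _ _ f C _ (fun=> erefl)))[q hq ->].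
  exact/qpi_eq0/mem_ideal_gen.
set f := qpi _.
have halfQ := rmorph_half f half.
apply: (@kills_star_rel _ _ (f \o C) halfQ).
  move=> _ /(@rat_rel_morph_inv _ _ _ f C _ (fun=> erefl))[q hq ->].
  exact/qpi_eq0/mem_ideal_gen.
exact: (star_rel_morph (@rmorph_hadamard _ _ _ f C _ (fun=> erefl))) hp.
Qed.

(** * Universal properties of quotients, tensor products and polynomial rings *)

Lemma qring_lift (A T : comPzRingType) (G : A -> Prop) (f : {rmorphism A -> T}) :
  (forall g, G g -> f g = 0) ->
  exists h : {rmorphism qring G -> T}, forall a, h (qpi G a) = f a.
Proof.
move=> fG; pose h (x : qring G) := f (qring_repr x).
(* The chosen representative differs from [a] by an element of the ideal, on which [f] vanishes. *)
have hE a : h (qpi G a) = f a.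
  apply/eqP; rewrite -subr_eq0 -rmorphB; apply/eqP.
  have /qpi_eq[s hs ->] := qring_reprK (qpi G a).
  rewrite rmorph_sum big_seq big1 // => x /hs/fG fx.
  by rewrite rmorphM fx mulr0.
have hB : zmod_morphism h.
  move=> x y; rewrite -[x]qring_reprK -[y]qring_reprK -rmorphB !hE.
  exact: rmorphB.
have hM : monoid_morphism h.
  split=> [|x y]; first by rewrite -(rmorph1 (qpi G)) hE rmorph1.
  rewrite -[x]qring_reprK -[y]qring_reprK -rmorphM !hE.
  exact: rmorphM.
pose h' : {rmorphism qring G -> T} := HB.pack h
  (GRing.isZmodMorphism.Build _ _ h hB) (GRing.isMonoidMorphism.Build _ _ h hM).
by exists h'.
Qed.

Section Tensor.
Variables A B : comPzRingType.

Definition tensl (a : A) : tensor A B := tens a 1.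
Definition tensr (b : B) : tensor A B := tens 1 b.

Fact tensl_is_zmod_morphism : zmod_morphism tensl.
Proof.
by move=> a b; apply: (addIr (tensl b)); rewrite subrK /tensl -tensDl subrK.
Qed.
Fact tensl_is_monoid_morphism : monoid_morphism tensl.
Proof. by split=> // a b; rewrite /tensl tensM mulr1. Qed.
HB.instance Definition _ :=
  GRing.isZmodMorphism.Build A _ tensl tensl_is_zmod_morphism.
HB.instance Definition _ :=
  GRing.isMonoidMorphism.Build A _ tensl tensl_is_monoid_morphism.

Fact tensr_is_zmod_morphism : zmod_morphism tensr.
Proof.
by move=> a b; apply: (addIr (tensr b)); rewrite subrK /tensr -tensDr subrK.
Qed.
Fact tensr_is_monoid_morphism : monoid_morphism tensr.
Proof. by split=> // a b; rewrite /tensr tensM mulr1. Qed.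
HB.instance Definition _ :=
  GRing.isZmodMorphism.Build B _ tensr tensr_is_zmod_morphism.
HB.instance Definition _ :=
  GRing.isMonoidMorphism.Build B _ tensr tensr_is_monoid_morphism.

Lemma tensE a b : tens a b = tensl a * tensr b.
Proof. by rewrite /tensl /tensr tensM mulr1 mul1r. Qed.

Variable T : comPzRingType.

Lemma tensor_ext (f g : {rmorphism tensor A B -> T}) :
  f \o tensl =1 g \o tensl -> f \o tensr =1 g \o tensr -> f =1 g.
Proof.
move=> fgl fgr x; rewrite -[x]qring_reprK; move: (qring_repr x).
apply: pair_ring_ext => [p q|p q|a b]; rewrite ?rmorphB //.
by rewrite -/(tens a b) tensE !rmorphM [f _]fgl [f _]fgr.
Qed.

(** The tensor product is the coproduct of commutative rings: the Z-linear extension of (a, b) -> f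
    a * g b is multiplicative on basis elements and kills the bilinearity relations. *)
Lemma tensor_lift (f : {rmorphism A -> T}) (g : {rmorphism B -> T}) :
  exists h : {rmorphism tensor A B -> T}, forall a b, h (tens a b) = f a * g b.
Proof.
(* [zmodule T] regards T as a module over [int], the coefficient ring of [pair_ring]. *)
pose L : pair_ring A B -> T := @fglift int (zmodule T) _ (fun x : A * B => f x.1 * g x.2).
have LE a b : L (pair_basis a b) = f a * g b by rewrite /L /pair_basis liftU scale1r.
have LB : zmod_morphism L by move=> p q; rewrite /L lift_is_additive.
have LM : monoid_morphism L.
  split=> [|p q]; first by rewrite -[RHS]mulr1 -{1}(rmorph1 f) -(rmorph1 g); exact: LE.
  move: p; apply: pair_ring_ext => [p p'|p p'|a b].
  - by rewrite mulrBl LB.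
  - by rewrite LB mulrBl.
  move: q; apply: pair_ring_ext => [q q'|q q'|a' b'].
  - by rewrite mulrBr LB.
  - by rewrite LB mulrBr.
  rewrite [_ * _ in LHS]pair_mulE !LE !rmorphM; ring.
pose L' : {rmorphism pair_ring A B -> T} := HB.pack L
  (GRing.isZmodMorphism.Build _ _ L LB) (GRing.isMonoidMorphism.Build _ _ L LM).
have [|h hE] := @qring_lift _ _ (@bilinear_rel A B) L'.
  by move=> _ [a a' b|a b b']; rewrite !rmorphB /= !LE rmorphD; ring.
by exists h => a b; rewrite [LHS]hE; apply: LE.
Qed.
End Tensor.

Arguments tensl {A} B a.
Arguments tensr A {B} b.

Lemma mpoly_ext n (R : comNzRingType) (T : comPzRingType)
    (f g : {rmorphism {mpoly R[n]} -> T}) :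
  (forall c, f c%:MP = g c%:MP) -> (forall i, f 'X_i = g 'X_i) -> f =1 g.
Proof.
move=> fgC fgX p; rewrite (mpolyE p) !rmorph_sum; apply: eq_bigr => m _ /=.
rewrite -mul_mpolyC mpolyXE_id !rmorphM !rmorph_prod fgC; congr (_ * _).
by apply: eq_bigr => i _; rewrite !rmorphXn fgX.
Qed.

Lemma mpoly_int_ext n (T : comPzRingType) (f g : {rmorphism {mpoly int[n]} -> T}) :
  (forall i, f 'X_i = g 'X_i) -> f =1 g.
Proof.
apply: mpoly_ext => c.
have -> : c%:MP_[n] = c%:~R by rewrite -[in LHS](intz c) rmorph_int.
by rewrite !rmorph_int.
Qed.

(* [mmap] needs a nonzero target; into the zero ring every map is a morphism. *)
Lemma mpoly_int_lift n (T : comPzRingType) (t : 'I_n -> T) :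
  exists f : {rmorphism {mpoly int[n]} -> T}, forall i, f 'X_i = t i.
Proof.
have [T0|/eqP T1] := pselect ((1 : T) = 0).
  have all0 (x y : T) : x = y by rewrite -[x]mul1r -[y]mul1r T0 !mul0r.
  pose z (_ : {mpoly int[n]}) : T := 0.
  have zB : zmod_morphism z by move=> ? ?; apply: all0.
  have zM : monoid_morphism z by split=> [|? ?]; apply: all0.
  pose z' : {rmorphism {mpoly int[n]} -> T} := HB.pack z
    (GRing.isZmodMorphism.Build _ _ z zB) (GRing.isMonoidMorphism.Build _ _ z zM).
  by exists z' => i; apply: all0.
pose T' : comNzRingType := HB.pack T (GRing.PzSemiRing_isNonZero.Build T T1).
exists (mmap (intr : int -> T') t : {rmorphism _ -> T'}) => i.
by rewrite /= mmapX mmap1U.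
Qed.

Lemma Zhalf_half : exists h : Zhalf, h * 2 = 1.
Proof.
have dyadic_half : (1 / 2 : rat) \in dyadic by apply/asboolP; exists 1%N.
by exists (MkZhalf dyadic_half); apply/val_inj; rewrite rmorphM rmorph_nat.
Qed.

(** * Morphisms out of a quotient of [cube_poly d int] tensored with Z[1/2] *)

Section TensorChow.
Variables (d : nat) (G : cube_poly d int -> Prop) (T : comPzRingType).
Local Notation A := (tensor (qring G) Zhalf).

(** This is C_v when G is [rat_rel], but the generator named F_v when G is [star_rel]. *)
Definition chow_var (v : cube d) : A := tensl Zhalf (qpi G (cube_var int v)).

Lemma tensor_chow_half : exists h : A, h * 2 = 1.
Proof. exact: (rmorph_half (tensr (qring G)) Zhalf_half). Qed.

Lemma tensor_chow_ext (U : comPzRingType) (f g : {rmorphism A -> U}) :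
  (forall v, f (chow_var v) = g (chow_var v)) ->
  (forall r, f (tensr _ r) = g (tensr _ r)) -> f =1 g.
Proof.
move=> fgC fgr; apply: tensor_ext => // x /=; rewrite -[x]qring_reprK.
move: (qring_repr x) => p; pose i := tensl Zhalf \o qpi G.
apply: (@mpoly_int_ext _ _ (f \o i) (g \o i) _ p) => k.
by have := fgC (enum_val k); rewrite /chow_var /cube_var enum_valK.
Qed.

Lemma tensor_chow_cancel (f : {rmorphism A -> T}) (g : {rmorphism T -> A}) :
  (forall v, g (f (chow_var v)) = chow_var v) ->
  (forall r, g (f (tensr _ r)) = tensr _ r) -> cancel f g.
Proof. by move=> gfC gfr x; apply: (tensor_chow_ext (f := g \o f) (g := idfun)). Qed.

(** The hypothesis ranges over all f with the prescribed values, since the evaluation morphism is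
    obtained only as an existence. *)
Lemma tensor_chow_lift (t : cube d -> T) (s : {rmorphism Zhalf -> T}) :
  (forall f : {rmorphism cube_poly d int -> T},
     (forall v, f (cube_var int v) = t v) -> forall g, G g -> f g = 0) ->
  exists h : {rmorphism A -> T},
    (forall v, h (chow_var v) = t v) /\ (forall r, h (tensr _ r) = s r).
Proof.
move=> tG; have [f fX] := @mpoly_int_lift #|{: cube d}| T (fun k => t (enum_val k)).
have ft v : f (cube_var int v) = t v by rewrite fX enum_rankK.
have [h hE] := qring_lift (tG f ft); have [k kE] := tensor_lift h s.
exists k; split=> [v|r]; rewrite kE rmorph1 ?mulr1 ?mul1r //.
by rewrite hE ft.
Qed.

Lemma tensl_qpi_hadamard w :
  tensl Zhalf (qpi G (hadamard (cube_var int) w)) = hadamard chow_var w.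
Proof. exact: (@rmorph_hadamard _ _ _ (tensl Zhalf \o qpi G)). Qed.
End TensorChow.

(** * The two mutually inverse morphisms of Chow rings over Z[1/2] *)

Lemma tensor_chow_liftE d (G H : cube_poly d int -> Prop)
    (f : {rmorphism tensor (qring G) Zhalf -> tensor (qring H) Zhalf}) w r :
  (forall v, f (chow_var G v) = hadamard (chow_var H) v) ->
  (forall r, f (tensr _ r) = tensr _ r) ->
  f (tens (qpi G (cube_var int w)) r) = tens (qpi H (hadamard (cube_var int) w)) r.
Proof.
move=> fX fr; rewrite [LHS](congr1 f (tensE _ _)) rmorphM fr fX.
by rewrite -tensl_qpi_hadamard -tensE.
Qed.

(** This makes X_w -> F_w well defined on [Chow_GS_tilde]. *)
Lemma chow_star_eq0 d : 
  kills (star_rel (hadamard (@chow_var d (rat_rel (cube_var int))))).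
Proof.
apply: kills_star_rel; first exact: tensor_chow_half.
move=> _ /(@rat_rel_morph_inv _ _ _ (tensl Zhalf \o qpi _)
  (cube_var int) _ (fun=> erefl))[q hq ->] /=.
by rewrite (qpi_eq0 _ _).2 ?rmorph0 //; apply: mem_ideal_gen.
Qed.

Lemma hadamardZ d (P : comPzRingType) (C : cube d -> P) (a : P) w :
  hadamard (fun v => a * C v) w = a * hadamard C w.
Proof. by rewrite mulr_sumr; apply: eq_bigr => v _; rewrite mulrCA. Qed.

Lemma hadamard_scaledK d (P : comPzRingType) (C : cube d -> P) (a : P) w :
  (exists h : P, h * 2 = 1) -> a * 2 ^+ d = 1 ->
  hadamard (fun v => a * hadamard C v) w = C w.
Proof. by move=> half a2; rewrite hadamardZ hadamardK // mulrA a2 mul1r. Qed.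

Lemma half_expn (P : comPzRingType) d :
  (exists h : P, h * 2 = 1) -> exists h : P, h * 2 ^+ d = 1.
Proof. by case=> h h2; exists (h ^+ d); rewrite -exprMn h2 expr1n. Qed.

Lemma eq_star_rel d (P : comPzRingType) (C C' : cube d -> P) :
  C =1 C' -> star_rel C = star_rel C'.
Proof. by move/funext->. Qed.

(** This makes X_v -> 2^-d F_v well defined on [Chow_GS]: the Hadamard transform of the new family
    is the family of variables, whose star relations hold by construction. *)
Lemma chow_rat_eq0 d (a : tensor (Chow_GS_tilde d) Zhalf) : a * 2 ^+ d = 1 ->
  kills (rat_rel (fun v => a * hadamard (@chow_var d (star_rel (cube_var int))) v)).
Proof.
move=> a2; have half := @tensor_chow_half d (star_rel (cube_var int)).
apply: kills_rat_rel => //.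
rewrite (eq_star_rel (fun w => hadamard_scaledK _ w half a2)).
move=> _ /(@star_rel_morph_inv _ _ _ (tensl Zhalf \o qpi _)
  (cube_var int) _ (fun=> erefl))[q hq ->] /=.
by rewrite (qpi_eq0 _ _).2 ?rmorph0 //; apply: mem_ideal_gen.
Qed.

(** On variables, both composites are the Hadamard transform applied twice and scaled by [b], the
    inverse of [2 ^+ d]. *)
Lemma hadamard_inverse d (S Q : comPzRingType) (s : {rmorphism Zhalf -> S})
    (q : {rmorphism Zhalf -> Q}) (X : cube d -> S) (Y : cube d -> Q) b
    (phi : {rmorphism S -> Q}) (psi : {rmorphism Q -> S}) :
  b * 2 ^+ d = 1 ->
  (forall v, phi (X v) = hadamard Y v) -> (forall r, phi (s r) = q r) ->
  (forall v, psi (Y v) = s b * hadamard X v) -> (forall r, psi (q r) = s r) ->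
  [/\ forall v, psi (phi (X v)) = X v, forall r, psi (phi (s r)) = s r,
      forall v, phi (psi (Y v)) = Y v & forall r, phi (psi (q r)) = q r].
Proof.
move=> b2 phiX phis psiY psiq.
have halfS := rmorph_half s Zhalf_half; have halfQ := rmorph_half q Zhalf_half.
have sb2 : s b * 2 ^+ d = 1 by rewrite -(rmorph_nat s) -rmorphXn -rmorphM b2 rmorph1.
have qb2 : q b * 2 ^+ d = 1 by rewrite -(rmorph_nat q) -rmorphXn -rmorphM b2 rmorph1.
split=> v; rewrite ?(phis, psiq) //.
  by rewrite phiX (rmorph_hadamard psiY) hadamard_scaledK.
by rewrite psiY rmorphM phis (rmorph_hadamard phiX) hadamardK // mulrA qb2 mul1r.
Qed.

Lemma chow_iso d :
  exists phi : {rmorphism tensor (Chow_GS_tilde d) Zhalf -> tensor (Chow_GS d) Zhalf},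
    bijective phi /\
    forall (w : cube d) (r : Zhalf),
      phi (tens (qpi _ (cube_var int w)) r) = tens (qpi _ (hadamard (cube_var int) w)) r.
Proof.
have [b b2] := half_expn d Zhalf_half.
have a2 : tensr (Chow_GS_tilde d) b * 2 ^+ d = 1.
  by rewrite -(rmorph_nat (tensr _)) -rmorphXn -rmorphM b2 rmorph1.
have [|phi [phiX phir]] := @tensor_chow_lift d (star_rel (cube_var int)) _
    (hadamard (@chow_var d _)) (tensr (Chow_GS d)).
  by move=> f fX g /(star_rel_morph fX) /chow_star_eq0.
have [|psi [psiY psir]] := @tensor_chow_lift d (rat_rel (cube_var int)) _
    (fun v => tensr _ b * hadamard (@chow_var d _) v) (tensr (Chow_GS_tilde d)).
  by move=> f fX g /(rat_rel_morph fX) /(chow_rat_eq0 a2).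
have [psiphiX psiphir phipsiY phipsir] := hadamard_inverse b2 phiX phir psiY psir.
have phiK := tensor_chow_cancel psiphiX psiphir.
have psiK := tensor_chow_cancel phipsiY phipsir.
exists phi; split; first exact: Bijective phiK psiK.
by move=> w r; apply: tensor_chow_liftE.
Qed.

(** * Polynomials over Z[1/2]: the extended ideal and the change of variables *)

Lemma intr_Zhalf_cube_var d v :
  map_mpoly (intr : int -> Zhalf) (cube_var int v : cube_poly d int) = cube_var Zhalf v.
Proof. exact: map_mpolyX. Qed.

(** The image of [I_rat] need not be an ideal; the ideal it generates is already generated by the
    images of the generators. *)
Lemma ideal_map_I_rat d (p : cube_poly d Zhalf) :
  ideal_gen (fun q => exists2 p0, I_rat d p0 & q = map_mpoly intr p0) p <->
  ideal_gen (rat_rel (cube_var Zhalf)) p.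
Proof.
split; apply: sub_ideal_gen => {}p; [case=> _ [s hs ->] ->|move=> hp].
  rewrite rmorph_sum big_seq; apply: big_ind => [|? ?|x xs].
  - exact: ideal_gen0.
  - exact: ideal_genD.
  rewrite rmorphM; apply/ideal_genMl/mem_ideal_gen.
  exact: (rat_rel_morph (@intr_Zhalf_cube_var d)) (hs _ xs).
have [q hq ->] := rat_rel_morph_inv (@intr_Zhalf_cube_var d) hp.
by apply: mem_ideal_gen; exists q => //; apply: mem_ideal_gen.
Qed.

Lemma comp_cube_var d (R : comNzRingType) (t : cube d -> cube_poly d R) v :
  cube_var R v \mPo [tuple t (enum_val i) | i < #|{: cube d}|] = t v.
Proof. by rewrite comp_mpolyXU -tnth_nth tnth_mktuple enum_rankK. Qed.

Lemma comp_hadamard d (R : comNzRingType) (t : cube d -> cube_poly d R) w :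
  hadamard (cube_var R) w \mPo [tuple t (enum_val i) | i < #|{: cube d}|] = hadamard t w.
Proof.
by apply: (@rmorph_hadamard _ _ _ (comp_mpoly _)) => v; apply: comp_cube_var.
Qed.

Lemma comp_cube_inv d (R : comNzRingType) (t u : cube d -> cube_poly d R) :
  (forall v, t v \mPo [tuple u (enum_val i) | i < #|{: cube d}|] = cube_var R v) ->
  cancel (fun p => p \mPo [tuple t (enum_val i) | i < #|{: cube d}|])
         (fun p => p \mPo [tuple u (enum_val i) | i < #|{: cube d}|]).
Proof.
move=> tu; set T := mktuple _; set U := mktuple _ => p.
apply: (@mpoly_ext _ _ _ (comp_mpoly U \o comp_mpoly T) idfun) p => [c|i] /=.
  by rewrite !comp_mpolyC.
have := comp_cube_var t (enum_val i); have := tu (enum_val i).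
by rewrite /cube_var enum_valK => <- ->.
Qed.

(** The inverse substitutes 2^-d F_v for the variable at v, so the F_w are again polynomial
    generators. *)
Lemma bijective_comp_hadamard d : bijective (fun p : cube_poly d Zhalf =>
  p \mPo [tuple hadamard (cube_var Zhalf) (enum_val i) | i < #|{: cube d}|]).
Proof.
have half : exists h : cube_poly d Zhalf, h * 2 = 1.
  exact: (rmorph_half (@mpolyC #|{: cube d}| Zhalf) Zhalf_half).
have [b b2] := half_expn d Zhalf_half.
pose a : cube_poly d Zhalf := b%:MP.
have a2 : a * 2 ^+ d = 1.
  rewrite -(rmorph_nat (@mpolyC #|{: cube d}| Zhalf)) -rmorphXn -rmorphM b2.
  exact: rmorph1.
pose F := hadamard (cube_var Zhalf : cube d -> _).
exists (fun p => p \mPo [tuple a * F (enum_val i) | i < #|{: cube d}|]).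
  apply: (@comp_cube_inv _ _ F (fun v => a * F v)) => v.
  transitivity (hadamard (fun u => a * F u) v).
    exact: comp_hadamard.
  exact: hadamard_scaledK.
apply: (@comp_cube_inv _ _ (fun v => a * F v) F) => v.
by rewrite rmorphM /= comp_mpolyC comp_hadamard hadamardK // mulrA a2 mul1r.
Qed.

Theorem theorem1p7 (d : nat) (hd : (0 < d)%N) :
  let F (R : comNzRingType) : cube d -> cube_poly d R := hadamard (cube_var R) in
  [/\ bijective (fun p : cube_poly d Zhalf =>
        p \mPo [tuple F Zhalf (enum_val i) | i < #|{: cube d}|]),
      forall p : cube_poly d Zhalf,
        ideal_gen (fun q => exists2 p0, I_rat d p0 & q = map_mpoly intr p0) p
        <-> ideal_gen (star_rel (F Zhalf)) p
    & exists phi : {rmorphism tensor (Chow_GS_tilde d) Zhalf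
                              -> tensor (Chow_GS d) Zhalf},
        bijective phi /\
        forall (w : cube d) (r : Zhalf),
          phi (tens (qpi _ (cube_var int w)) r) = tens (qpi _ (F int w)) r].
Proof.
split; first exact: bijective_comp_hadamard.
  move=> p; rewrite ideal_map_I_rat; apply: ideal_rat_star.
  exact: (rmorph_half (@mpolyC #|{: cube d}| Zhalf) Zhalf_half).
exact: chow_iso.
Qed.
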